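(* Let $K$ be an algebraically closed field of characteristic zero, $l\in\mathbb{N}$, let $m,n\in\mathbb{N}$ be coprime with $m,n>1$, and let $P,Q\in L^{(l)}$ with $$[P,Q]\in K^\times\quad\text{and}\quad \frac{v_{1,1}(P)}{v_{1,1}(Q)}=\frac{v_{1,0}(P)}{v_{1,0}(Q)}=\frac mn .$$ Take $T_0\in K[P,Q]$ and set $T_j:=[T_{j-1},P]$ for $j\ge1$. Assume that $(\rho_0,\sigma_0)\in\mathfrak{V}_{\ge0}$ satisfies: (1) $(\rho_0,\sigma_0)\in\mathrm{Dir}(P)$ and $v_{\rho_0,\sigma_0}(P)>0$; (2) $\mathrm{en}_{\rho_0,\sigma_0}(T_j)\sim\mathrm{en}_{\rho_0,\sigma_0}(P)$ for all $j$ with $T_j\ne0$; (3) $\frac1m\mathrm{en}_{\rho_0,\sigma_0}(P)=\frac1n\mathrm{en}_{\rho_0,\sigma_0}(Q)\in\frac1l\mathbb{Z}\times\mathbb{N}$; (4) $b>a/l$, where $(a/l,b):=\frac1m\mathrm{en}_{\rho_0,\sigma_0}(P)$. Let $I_0:=[(\rho_0,\sigma_0),(0,-1)[$ and $$(\tilde\rho,\tilde\sigma):=\max\{(\rho,\sigma)\in\mathrm{Dir}(P)\cap I_0: v_{\rho',\sigma'}(P)>0\text{ for all }(\rho_0,\sigma_0)\le(\rho',\sigma')\le(\rho,\sigma)\}.$$ Then for all $(\rho,\sigma)\in\mathfrak{V}$ with $(\rho_0,\sigma_0)<(\rho,\sigma)\le(\tilde\rho,\tilde\sigma)$ and all $j\ge0$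 we have $$[\ell_{\rho,\sigma}(T_j),\ell_{\rho,\sigma}(P)]=0\quad\text{and}\quad\frac{v_{\rho,\sigma}(T_j)}{v_{\rho,\sigma}(P)}=\frac{v_{\rho_0,\sigma_0}(T_j)}{v_{\rho_0,\sigma_0}(P)}.$$
   Context: $\mathbb{N}$ is the set of positive integers. $L^{(l)}=K[x^{1/l},x^{-1/l},y]$, and $[P,Q]:=\partial_xP\,\partial_yQ-\partial_xQ\,\partial_yP$ for $P,Q\in L^{(l)}$. $K[P,Q]$ is the $K$-subalgebra generated by $P,Q$. Directions: $\mathfrak{V}=\{(\rho,\sigma)\in\mathbb{Z}^2:\gcd(\rho,\sigma)=1\}$, $\mathfrak{V}_{\ge0}=\{(\rho,\sigma)\in\mathfrak{V}:\rho+\sigma\ge0\}$. Identifying a direction with its unit vector in $S^1$, an interval in $\mathfrak{V}$ is the preimage of an arc that is not the whole circle, ordered increasingly counterclockwise; $[A,B[$ is the arc going counterclockwise from $A$ (included) to $B$ (excluded), and the inequalities in the claim refer to the order of $I_0$. For $(\rho,\sigma)\in\mathfrak{V}$ and $P=\sum a_{i/l,j}x^{i/l}y^j\ne0$: $\mathrm{Supp}(P)=\{(i/l,j):a_{i/l,j}\neq0\}$, $v_{\rho,\sigma}(i/l,j)=\rho i/l+\sigma j$, $v_{\rho,\sigma}(P)=\max v_{\rho,\sigma}$ over $\mathrm{Supp}(P)$, and $\ell_{\rho,\sigma}(P)$ is the sum of the terms of $P$ attaining this maximum; $v_{\rho,\sigma}(0)=-\infty$, $\ell_{\rho,\sigma}(0)=0$.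 $\mathrm{Dir}(P)=\{(\rho,\sigma)\in\mathfrak{V}:\#\mathrm{Supp}(\ell_{\rho,\sigma}(P))>1\}$. The cross product is $(a_1,a_2)\times(b_1,b_2)=a_1b_2-a_2b_1$, and $A\sim B$ means $A\times B=0$. If $\ell_{\rho,\sigma}(P)$ is a monomial, $\mathrm{st}_{\rho,\sigma}(P)=\mathrm{en}_{\rho,\sigma}(P)$ is its exponent; otherwise they are the two endpoints of the segment spanned by $\mathrm{Supp}(\ell_{\rho,\sigma}(P))$, ordered so that $(\rho,\sigma)\times(\mathrm{en}_{\rho,\sigma}(P)-\mathrm{st}_{\rho,\sigma}(P))>0$. *)

(* Defs.v *)
From HB Require Import structures.
From mathcomp Require Import all_boot all_order all_algebra finmap.
From mathcomp Require Import boolp classical_sets constructive_ereal.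
(* [-(notations)]: the notations of monalg clash with those of classical_sets *)
From mathcomp Require Import -(notations) monalg.

Set Implicit Arguments.
Unset Strict Implicit.
Unset Printing Implicit Defensive.

Import Order.TTheory GRing.Theory Num.Theory.
Local Open Scope ring_scope.

(* L^(l) = K[x^(1/l), x^(-1/l), y]: the key (i, j) stands for the monomial
   x^(i/l) y^j.  The type does not depend on l up to conversion; l is used for
   the derivative in x and for exponents.  (monalg's own algebra structure
   requires a monomial type without nontrivial units, which excludes negative
   powers of x, so the product is defined here.) *)
Definition lpoly (K : comNzRingType) (l : nat) : Type :=
  malg (int * nat)%type K.

HB.instance Definition _ (K : comNzRingType) (l : nat) :=
  GRing.Lmodule.on (lpoly K l).

Section Algebra.
Context {K : comNzRingType} {l : nat}.
Implicit Types (P Q T : lpoly K l) (k : int * nat).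

Definition mon (c : K) k : lpoly K l := mkmalgU k c.

Definition coef P k : K := mcoeff k P.

Definition lone : lpoly K l := mon 1 0.

Definition lmul P Q : lpoly K l :=
  \sum_(k1 <- msupp P) \sum_(k2 <- msupp Q)
    mon (coef P k1 * coef Q k2) (k1 + k2).

Lemma mon0 k : mon 0 k = 0.
Proof. exact: monalgU0. Qed.

Lemma monD c1 c2 k : mon (c1 + c2) k = mon c1 k + mon c2 k.
Proof. exact: monalgUD. Qed.

Lemma coefD P Q k : coef (P + Q) k = coef P k + coef Q k.
Proof. exact: mcoeffD. Qed.

Lemma coefZ c P k : coef (c *: P) k = c * coef P k.
Proof. exact: mcoeffZ. Qed.

Lemma coef_mon c k k' : coef (mon c k) k' = c *+ (k == k').
Proof. exact: mcoeffU. Qed.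

Lemma lpolyE P : P = \sum_(k <- msupp P) mon (coef P k) k.
Proof. exact: monalgE. Qed.

Lemma lmulw (d1 d2 : {fset int * nat}) P Q :
    (msupp P `<=` d1)%fset -> (msupp Q `<=` d2)%fset ->
  lmul P Q = \sum_(k1 <- d1) \sum_(k2 <- d2)
    mon (coef P k1 * coef Q k2) (k1 + k2).
Proof.
move=> le_d1 le_d2; rewrite /lmul (big_fset_incl _ le_d1) /=.
  apply/eq_bigr=> k1 _; apply/big_fset_incl => // k _ /mcoeff_outdom.
  by rewrite -/(coef Q k) => ->; rewrite mulr0 mon0.
move=> k _ /mcoeff_outdom; rewrite -/(coef P k) => Pk.
by rewrite big1 => // k' _; rewrite Pk mul0r mon0.
Qed.

Lemma lmulC : commutative lmul.
Proof.
move=> P Q; rewrite /lmul exchange_big; apply/eq_bigr=> k1 _.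
by apply/eq_bigr=> k2 _; rewrite mulrC addrC.
Qed.

Lemma lmulDl : left_distributive lmul +%R.
Proof.
move=> P Q T; rewrite [in RHS](lmulw (fsubsetUl _ (msupp Q)) (fsubset_refl _)).
rewrite [in RHS](lmulw (fsubsetUr (msupp P) _) (fsubset_refl _)).
rewrite (lmulw (msuppD_le _ _) (fsubset_refl _)).
rewrite -big_split /=; apply/eq_bigr=> k1 _.
rewrite -big_split /=; apply/eq_bigr=> k2 _.
by rewrite coefD mulrDl monD.
Qed.

Lemma lmulDr : right_distributive lmul +%R.
Proof. by move=> P Q T; rewrite lmulC lmulDl !(lmulC _ P). Qed.

Lemma lmul0l P : lmul 0 P = 0.
Proof. by rewrite /lmul msupp0 big_seq_fset0. Qed.

Lemma lmul0r P : lmul P 0 = 0.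
Proof. by rewrite lmulC lmul0l. Qed.

Lemma lmulUU c1 c2 k1 k2 :
  lmul (mon c1 k1) (mon c2 k2) = mon (c1 * c2) (k1 + k2).
Proof.
by rewrite (lmulw msuppU_le msuppU_le) !big_seq_fset1 !coef_mon !eqxx.
Qed.

Lemma lmul_suml (I : Type) (r : seq I) (F : I -> lpoly K l) Q :
  lmul (\sum_(i <- r) F i) Q = \sum_(i <- r) lmul (F i) Q.
Proof.
exact: (big_morph (lmul^~ Q) (fun _ _ => lmulDl _ _ _) (lmul0l _)).
Qed.

Lemma lmul_sumr (I : Type) (r : seq I) (F : I -> lpoly K l) Q :
  lmul Q (\sum_(i <- r) F i) = \sum_(i <- r) lmul Q (F i).
Proof. by rewrite lmulC lmul_suml; under eq_bigr do rewrite lmulC. Qed.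

Lemma lmulA : associative lmul.
Proof.
move=> P Q T; rewrite (lpolyE P) !lmul_suml; apply/eq_bigr=> k1 _.
rewrite (lpolyE Q) lmul_sumr !lmul_suml lmul_sumr; apply/eq_bigr=> k2 _.
rewrite (lpolyE T) !lmul_sumr; apply/eq_bigr=> k3 _.
by rewrite !lmulUU mulrA addrA.
Qed.

Lemma lmul1l : left_id lone lmul.
Proof.
move=> P; rewrite {1}(lpolyE P) lmul_sumr [RHS]lpolyE.
by apply/eq_bigr=> k _; rewrite lmulUU mul1r add0r.
Qed.

Lemma lone_neq0 : lone != 0.
Proof.
apply/eqP=> /(congr1 (coef^~ 0)); rewrite coef_mon eqxx /coef mcoeff0.
by apply/eqP; exact: oner_neq0.
Qed.

HB.instance Definition _ := GRing.Zmodule_isComNzRing.Build (lpoly K l)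
  lmulA lmulC lmul1l lmulDl lone_neq0.

Lemma lscaleAl c P Q : c *: lmul P Q = lmul (c *: P) Q.
Proof.
have sE a R : a *: R = lmul (mon a 0) R.
  rewrite [in RHS](lpolyE R) lmul_sumr [in LHS](lpolyE R) scaler_sumr.
  apply/eq_bigr=> k _; rewrite lmulUU add0r; apply/malgP=> k'.
  by rewrite -!/(coef _ k') coefZ !coef_mon mulrnAr.
by rewrite !sE lmulA.
Qed.

HB.instance Definition _ :=
  GRing.Lmodule_isLalgebra.Build K (lpoly K l) lscaleAl.
HB.instance Definition _ := GRing.Lalgebra_isComAlgebra.Build K (lpoly K l).

(* T \in K[P, Q] *)
Definition in_subalg P Q T : Prop :=
  forall S : {pred lpoly K l},
    GRing.subalg_closed S -> P \in S -> Q \in S -> T \in S.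

End Algebra.

Section Bracket.
Context {K : fieldType} {l : nat}.
Implicit Types (P Q T : lpoly K l).

Definition dx P : lpoly K l :=
  \sum_(k <- msupp P) mon (coef P k * (k.1%:~R / l%:R)) (k.1 - l%:Z, k.2).

Definition dy P : lpoly K l :=
  \sum_(k <- msupp P) mon (coef P k *+ k.2) (k.1, k.2.-1).

Definition bracket P Q : lpoly K l := dx P * dy Q - dy P * dx Q.

Definition iter_bracket T0 P (j : nat) : lpoly K l :=
  iter j (fun T => bracket T P) T0.

End Bracket.

Definition cross {R : nzRingType} (a b : R * R) : R := a.1 * b.2 - a.2 * b.1.

Definition scale_pt (c : rat) (p : rat * rat) : rat * rat :=
  (c * p.1, c * p.2).

Section Directions.
Implicit Types (A B u v : int * int).

Definition direction u : bool := coprimez u.1 u.2.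

(* The counterclockwise angle from A to u lies in [0, pi[ (A, u directions). *)
Definition first_half A u : bool := (u == A) || (0 < cross A u).

(* The counterclockwise angle from A to u, taken in [0, 2 pi[, is smaller than
   the one from A to v: two directions in the same half turn are compared by
   their cross product.  On an arc starting at A this is the counterclockwise
   order. *)
Definition ccw_lt A u v : bool :=
  if first_half A u == first_half A v then 0 < cross u v else first_half A u.

Definition ccw_le A u v : bool := (u == v) || ccw_lt A u v.

(* The interval [A, B[, for A <> B. *)
Definition ccw_arc A B : set (int * int) :=
  [set u | direction u /\ ccw_lt A u B]%classic.

End Directions.

Section Valuations.
Context {K : fieldType} {l : nat}.
Implicit Types (P : lpoly K l) (u : int * int).

Definition expo (k : int * nat) : rat * rat := (k.1%:~R / l%:R, k.2%:R).

Definition Supp P : seq (rat * rat) := [seq expo k | k <- msupp P].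

Definition vpt u (p : rat * rat) : rat := u.1%:~R * p.1 + u.2%:~R * p.2.

(* v_u(P), with value -oo at P = 0.  Quotients of such values are taken in
   \bar rat: -oo / r = -oo for r > 0, and x / 0 is never finite and nonzero. *)
Definition vdeg u P : \bar rat :=
  \big[maxe/-oo%E]_(p <- Supp P) (vpt u p)%:E.

Definition ell u P : lpoly K l :=
  \sum_(k <- msupp P | (vpt u (expo k))%:E == vdeg u P) mon (coef P k) k.

Definition Dir P : set (int * int) :=
  [set u | direction u /\ (1 < size (Supp (ell u P)))%N]%classic.

(* (s, e) = (st_u(P), en_u(P)); when ell u P is a monomial the first three
   conditions say that s = e is its exponent. *)
Definition is_st_en u P (s e : rat * rat) : Prop :=
  [/\ s \in Supp (ell u P), e \in Supp (ell u P),
      (forall p, p \in Supp (ell u P) ->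
         exists2 t : rat, 0 <= t <= 1 & p = s + scale_pt t (e - s))
    & (1 < size (Supp (ell u P)))%N ->
      0 < cross (u.1%:~R, u.2%:~R) (e - s)].

(* The value at P = 0 is irrelevant. *)
Definition st_en u P : (rat * rat) * (rat * rat) :=
  xget (0, 0) [set se | is_st_en u P se.1 se.2]%classic.

Definition en u P : rat * rat := (st_en u P).2.

End Valuations.


(* For A = (rho0, sigma0), (rho~, sigma~) is the greatest element of this set
   for ccw_le A. *)
Definition pos_Dir (K : fieldType) (l : nat) (P : lpoly K l) (A : int * int) :
    set (int * int) :=
  [set u | [/\ Dir P u, ccw_arc A (0, -1) u
     & forall w, direction w -> ccw_le A A w -> ccw_le A w u ->
         (0 < vdeg w P)%E]]%classic.

(* Main.v *)
(* Induct downwards along T_j = [T_(j-1), P], which ends in 0 because [-, P] is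
   locally nilpotent on K[P, Q].  Suppose the claim holds for [T, P].  Going
   counterclockwise from (rho0, sigma0), the end point of a leading form is the
   starting point of the next one, so the starting points of l_u(T) and l_u(P)
   stay proportional until l_u(T) and l_u(P) fail to commute at some direction
   u.  There l_u([T, P]) = [l_u(T), l_u(P)], and its starting point lies strictly
   past st(T) + st(P) - (1, 1) on the same line; as it is also proportional to
   st_u(P) = (x, y), some rational c satisfies
     c v_u(x, y) = v_u(1, 1)   and   u x c(x, y) < u x (1, 1),
   whence |u|^2 (y - x) < 0.  But st_u(P) always lies above the diagonal: while
   rho + sigma > 0 this is inherited from en_(rho0, sigma0)(P), and afterwards it
   follows from v_u(P) > 0 and y >= 0. *)
From HB Require Import structures.
Require Import Defs.
From mathcomp Require Import all_boot all_order all_algebra finmap.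
From mathcomp Require Import boolp classical_sets constructive_ereal.
From mathcomp Require Import -(notations) monalg.
From mathcomp Require Import ring lra zify.

Set Implicit Arguments.
Unset Strict Implicit.
Unset Printing Implicit Defensive.

Import Order.TTheory GRing.Theory Num.Theory.
Local Open Scope ring_scope.

(** * Directions and their counterclockwise order *)

Section CcwOrder.
Implicit Types A d u v w : int * int.

Lemma direction_neq0 u : direction u -> u.1 != 0 \/ u.2 != 0.
Proof.
rewrite /direction; case: (eqVneq u.1 0) => [->|]; last by left.
by case: (eqVneq u.2 0) => [->|]; [|right].
Qed.

Lemma direction_norm_gt0 u : direction u -> 0 < u.1 * u.1 + u.2 * u.2.
Proof. by move=> /direction_neq0; nia. Qed.

(** A Bezout relation for [u] yields an integer [k] with [v = k u]; a Bezout relation for [v] then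
    makes [k] a unit of the integers. *)
Lemma cross_eq0_direction u v :
  direction u -> direction v -> cross u v = 0 -> u = v \/ u = (- v.1, - v.2).
Proof.
case: u v => [a b] [c d]; rewrite /direction /cross /=.
move=> /coprimezP[[s t] /= st] /coprimezP[[p q] /= pq] /eqP.
rewrite subr_eq0 => /eqP E; pose k := s * c + t * d.
have ck : c = a * k.
  have -> : a * k = c * (s * a + t * b) + t * (a * d - b * c) by rewrite /k; ring.
  by rewrite st E subrr; ring.
have dk : d = b * k.
  have -> : b * k = d * (s * a + t * b) - s * (a * d - b * c) by rewrite /k; ring.
  by rewrite st E subrr; ring.
have /intUnitRing.unitzPl/orP[] : (p * a + q * b) * k = 1.
- by rewrite -pq ck dk; ring.
- by move/eqP=> k1; left; rewrite ck dk k1 !mulr1.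
- by move/eqP=> k1; right; rewrite ck dk k1 !mulrN1 !opprK.
Qed.

Definition primitive v : int * int :=
  ((v.1 %/ gcdz v.1 v.2)%Z, (v.2 %/ gcdz v.1 v.2)%Z).

Lemma primitiveP v : v.1 != 0 \/ v.2 != 0 ->
  direction (primitive v) /\
  exists2 g : int, 0 < g & v.1 = (primitive v).1 * g /\ v.2 = (primitive v).2 * g.
Proof.
move=> v0; have g_gt0 : 0 < gcdz v.1 v.2.
  by rewrite lt0r gcdz_eq0 andbC; case: v0 => /negPf ->; rewrite ?andbF.
have E1 : v.1 = (primitive v).1 * gcdz v.1 v.2 by rewrite divzK ?dvdz_gcdl.
have E2 : v.2 = (primitive v).2 * gcdz v.1 v.2 by rewrite divzK ?dvdz_gcdr.
split; last by exists (gcdz v.1 v.2).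
have [s [t st]] := Bezoutz v.1 v.2.
apply/coprimezP; exists (s, t) => /=.
apply: (mulIf (lt0r_neq0 g_gt0)); by rewrite mul1r -[RHS]st mulrDl -!mulrA -E1 -E2.
Qed.


(** The two directions parallel to [A] appear as equations; after substitution every comparison of
    angles becomes an integer inequality. *)
Variant ccw_half_spec A u : bool -> Type :=
| FirstHalfA of u = A : ccw_half_spec A u true
| FirstHalf of 0 < cross A u : ccw_half_spec A u true
| SecondHalfOpp of u = (- A.1, - A.2) : ccw_half_spec A u false
| SecondHalf of cross A u < 0 : ccw_half_spec A u false.

Lemma ccw_halfP A u : direction A -> direction u ->
  ccw_half_spec A u (first_half A u).
Proof.
move=> Ad ud; rewrite /first_half; case: eqVneq => [->|uA] /=.
  exact: FirstHalfA.
case: ltrgtP => c0; [exact: FirstHalf|exact: SecondHalf|].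
apply: SecondHalfOpp; have [] // := cross_eq0_direction ud Ad.
  by move: c0; rewrite /cross; lia.
by move/eqP; rewrite (negPf uA).
Qed.

Lemma ccw_lt_irr A u : ccw_lt A u u = false.
Proof. by rewrite /ccw_lt eqxx /cross mulrC subrr ltxx. Qed.

Lemma ccw_lt_trans A u w z : direction A -> direction u -> direction w ->
  direction z -> ccw_lt A u w -> ccw_lt A w z -> ccw_lt A u z.
Proof.
move=> Ad ud wd zd; have A0 := direction_norm_gt0 Ad.
(* The Plücker relation between the four vectors settles the case where all angles lie in one half
   turn. *)
have E : cross A w * cross u z = cross A u * cross w z + cross A z * cross u w.
  by rewrite /cross; ring.
rewrite /ccw_lt; case: (ccw_halfP Ad ud); case: (ccw_halfP Ad wd);
  case: (ccw_halfP Ad zd) => //= Hz Hw Hu; subst => //= uw wz;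
  by [nia | rewrite /cross /= in E uw wz Hz Hw Hu *; lia
    | unfold cross in *; simpl in *; lia].
Qed.

Lemma ccw_le_lt_trans A u w z : direction A -> direction u -> direction w ->
  direction z -> ccw_le A u w -> ccw_lt A w z -> ccw_lt A u z.
Proof.
by move=> Ad ud wd zd /orP[/eqP ->//|]; apply: ccw_lt_trans.
Qed.

Lemma ccw_lt_self A u : direction A -> direction u -> u != A -> ccw_lt A A u.
Proof.
move=> Ad ud uA; rewrite /ccw_lt /first_half eqxx (negPf uA) /=.
by case: (ltP 0 (cross A u)).
Qed.


(** Seen from [A], the two test directions lie at angles pi and pi/2. If neither separates [d] from
    [u], the turn from [d] to [u] is below pi. The quarter turn rules out [d = A] with [u] opposite
    to [A]. *)
Lemma ccw_lt_gap A d u : direction A -> direction d -> direction u ->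
    ccw_lt A d u ->
    (forall w, w \in [:: (- A.1, - A.2); (- A.2, A.1)] ->
       ccw_lt A d w -> ccw_lt A w u -> False) ->
  0 < cross d u.
Proof.
move=> Ad dd ud; have A0 := direction_norm_gt0 Ad.
set A' := (- A.1, - A.2); set Ap := (- A.2, A.1) => du gap.
have A'd : direction A' by rewrite /direction /= coprimezN coprimeNz.
have Apd : direction Ap by rewrite /direction /= coprimeNz coprimez_sym.
have := gap A' (mem_head _ _); have := gap Ap; rewrite !inE eqxx orbT.
move/(_ isT); move: du; rewrite /ccw_lt.
have -> : first_half A A' = false.
  apply/negP => /orP[/eqP A'A|]; last by rewrite /cross /=; lia.
  by have := congr1 fst A'A; have := congr1 snd A'A; rewrite /=; nia.
have -> : first_half A Ap.
  by rewrite /first_half /Ap /cross /=; apply/orP; right; lia.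
case: (ccw_halfP Ad dd) => [-> | Ad0 | -> | Ad0];
  case: (ccw_halfP Ad ud) => [-> | Au0 | -> | Au0] //=;
  unfold cross in *; simpl in * => du g1 g2; nia.
Qed.

(** The Plücker relation makes [cross A w], up to a positive factor, a positive combination of
    [cross A d] and [cross A u], which locates the half turn of [w]. *)
Lemma ccw_lt_cone A d w u : direction A -> direction d -> direction w ->
    direction u -> ccw_lt A d u -> 0 < cross d u ->
  0 < cross d w -> 0 < cross w u -> ccw_lt A d w /\ ccw_lt A w u.
Proof.
move=> Ad dd wd ud; have A0 := direction_norm_gt0 Ad.
have E : cross A w * cross d u = cross A d * cross w u + cross A u * cross d w.
  by rewrite /cross; ring.
rewrite /ccw_lt; case: (ccw_halfP Ad ud) => Hu; case: (ccw_halfP Ad wd) => Hw;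
  case: (ccw_halfP Ad dd) => //= Hd; subst => //= du du' dw wu; split => //; exfalso;
  try nia; unfold cross in *; simpl in *; nia.
Qed.


(** * Induction along a finite set of directions *)

Section Predecessor.
Context (A : int * int) (D : seq (int * int)).
Hypotheses (Ad : direction A) (Dd : {in D, forall d, direction d}).

(** The rank of [u] relative to [D]: a natural number measuring progress, defined also for
    directions outside [D]. *)
Let below u := count (fun d => ccw_lt A d u) D.

Lemma below_lt d u : d \in D -> direction u -> ccw_lt A d u -> (below d < below u)%N.
Proof.
move=> dD ud du; have dd := Dd dD.
have -> : below d = count (fun w => ccw_lt A w d) [seq w <- D | ccw_lt A w u].
  rewrite count_filter; apply: eq_in_count => w wD /=.
  by case wd: (ccw_lt A w d) => //=; rewrite (ccw_lt_trans _ _ dd) // Dd.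
rewrite /below -[X in (_ < X)%N]size_filter ltn_neqAle count_size andbT -all_count.
by apply/allPn; exists d; rewrite ?mem_filter ?du // ccw_lt_irr.
Qed.

Lemma ccw_ind (S : int * int -> Prop) :
    (forall u, direction u ->
       (forall d, d \in D -> ccw_lt A d u -> S d) -> S u) ->
  forall u, direction u -> S u.
Proof.
move=> IH u; have [k] := ubnP (below u).
elim: k u => // k IHk u uk ud; apply: IH => // d dD du.
apply: IHk (Dd dD); apply: leq_trans (below_lt dD ud du) _.
by rewrite -ltnS.
Qed.

Lemma ccw_predecessor u : direction u -> A \in D -> ccw_lt A A u ->
  exists d, [/\ d \in D, ccw_lt A d u &
    forall w, w \in D -> ccw_lt A d w -> ccw_lt A w u -> False].
Proof.
move=> ud AD Au.
(* Start at [A] and move to an element strictly between as long as there is one. The rank grows at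
   each move and never exceeds [size D], so [k] bounds the number of moves left. *)
suff /(_ (size D).+1 A) : forall k d, (size D < below d + k)%N -> d \in D ->
    ccw_lt A d u ->
  exists d, [/\ d \in D, ccw_lt A d u &
    forall w, w \in D -> ccw_lt A d w -> ccw_lt A w u -> False].
  by apply => //; rewrite addnS ltnS leq_addl.
elim=> [|k IHk] d dk dD du.
  by move: dk; rewrite addn0 ltnNge count_size.
have [/hasP[w wD /andP[dw wu]]|/hasPn gap] :=
    boolP (has (fun w => ccw_lt A d w && ccw_lt A w u) D).
  apply: (IHk w) => //; apply: leq_trans dk _.
  by rewrite addnS -addSn leq_add2r (below_lt dD (Dd wD) dw).
exists d; split=> // w wD dw wu.
by have := gap w wD; rewrite dw wu.
Qed.
End Predecessor.

(** The half plane of positive coordinate sum runs counterclockwise from (1, -1) to (-1, 1). The arc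
    stops at (0, -1), before it could enter this half plane again, so [u] is less than a half turn
    past [A]. *)
Lemma ccw_arc_sum_gt0 A u : direction A -> 0 <= A.1 + A.2 -> direction u ->
  u != A -> ccw_lt A u (0, -1) -> 0 < u.1 + u.2 -> 0 < cross A u.
Proof.
move=> Ad A0 ud uA; have Bd : direction (0, -1) by [].
have := direction_norm_gt0 ud; have := direction_norm_gt0 Ad.
rewrite /ccw_lt; case: (ccw_halfP Ad ud) => [uE|Au|?|Au] /=;
  first by move: uA; rewrite uE eqxx.
all: case: (ccw_halfP Ad Bd) => [?|AB|E|AB] //=; subst => //=;
  unfold cross in *; simpl in *; try nia.
by case: E; lia.
Qed.


(** What remains of the arc runs from (-1, 1) to (0, -1), the latter excluded, inside the left half
    plane. *)
Lemma ccw_arc_sum_le0 A u : direction A -> 0 <= A.1 + A.2 -> direction u ->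
  u != A -> ccw_lt A u (0, -1) -> u.1 + u.2 <= 0 -> u.1 < 0.
Proof.
move=> Ad A0 ud uA; have Bd : direction (0, -1) by [].
have := direction_norm_gt0 ud.
rewrite /ccw_lt; case: (ccw_halfP Ad ud) => [uE|Au|?|Au] /=;
  first by move: uA; rewrite uE eqxx.
all: case: (ccw_halfP Ad Bd) => [?|AB|E|AB] //=; subst => //=;
  unfold cross in *; simpl in *; try nia.
by case: E; lia.
Qed.

End CcwOrder.

(** * Derivations and the Jacobian bracket *)

Section AbstractDerivations.
Variable R : comNzRingType.
Implicit Types (D : {additive R -> R}) (f g h : R).

(** Here [gen] generates additively, as monomials do. Both sides of the Leibniz rule are biadditive,
    so it suffices to check it on [gen]. *)
Lemma derivation_ind D (gen : R -> Prop) :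
    (forall S : R -> Prop, S 0 -> (forall f g, S f -> S g -> S (f + g)) ->
       (forall f, gen f -> S f) -> forall f, S f) ->
    (forall f g, gen f -> gen g -> D (f * g) = D f * g + f * D g) ->
  forall f g, D (f * g) = D f * g + f * D g.
Proof.
move=> gen_ind Dgen + g;
  apply: (gen_ind (fun f => D (f * g) = D f * g + f * D g)) => [|f f' IHf IHf'|f genf].
- by rewrite !(mul0r, raddf0) addr0.
- by rewrite mulrDl !raddfD IHf IHf' /=; ring.
move: g; apply: (gen_ind (fun g => D (f * g) = D f * g + f * D g))
  => [|g g' IHg IHg'|g geng]; last exact: Dgen.
- by rewrite !(mulr0, raddf0) addr0.
- by rewrite mulrDr !raddfD IHg IHg' /=; ring.
Qed.

Variables Dx Dy : {additive R -> R}.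
Hypothesis DxM : forall f g, Dx (f * g) = Dx f * g + f * Dx g.
Hypothesis DyM : forall f g, Dy (f * g) = Dy f * g + f * Dy g.
Let br f g := Dx f * Dy g - Dy f * Dx g.

Lemma abstract_bracketDl f g h : br (f + g) h = br f h + br g h.
Proof. by rewrite /br !raddfD /=; ring. Qed.

Lemma abstract_bracketDr f g h : br h (f + g) = br h f + br h g.
Proof. by rewrite /br !raddfD /=; ring. Qed.

Lemma abstract_bracket0l f : br 0 f = 0.
Proof. by rewrite /br !raddf0; ring. Qed.

(** Used with the leading forms as [f'] and [g']; the last two brackets then collect the terms of
    lower degree. *)
Lemma abstract_bracket_split f g f' g' :
  br f g = br f' g' + (br f' (g - g') + br (f - f') g).
Proof. by rewrite /br !raddfB /=; ring. Qed.

Lemma abstract_bracketC f g : br f g = - br g f.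
Proof. by rewrite /br; ring. Qed.

Lemma abstract_bracketMl f g h : br (f * g) h = br f h * g + f * br g h.
Proof. by rewrite /br DxM DyM; ring. Qed.

Lemma abstract_bracketll f : br f f = 0.
Proof. by rewrite /br; ring. Qed.

End AbstractDerivations.

Section BracketTheory.
Context {K : fieldType} {l : nat}.
Implicit Types (f g h P Q : lpoly K l) (k : int * nat) (c : K).

Lemma coef_neq0 f k : (k \in msupp f) = (coef f k != 0).
Proof. by rewrite -mcoeff_neq0. Qed.

Lemma lcoef_sum (I : Type) (r : seq I) (C : pred I) (F : I -> lpoly K l) k :
  coef (\sum_(i <- r | C i) F i) k = \sum_(i <- r | C i) coef (F i) k.
Proof.
apply: (big_morph (fun f : lpoly K l => coef f k)) => [f g|].
  exact: Defs.coefD.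
exact: mcoeff0.
Qed.

Lemma lcoefN f k : coef (- f) k = - coef f k.
Proof. exact: mcoeffN. Qed.

Lemma coef0 k : coef (0 : lpoly K l) k = 0.
Proof. exact: mcoeff0. Qed.

Lemma lpolyP f g : (forall k, coef f k = coef g k) -> f = g.
Proof. by move=> fg; apply/malgP. Qed.

Lemma monM c1 c2 k1 k2 :
  (mon c1 k1 : lpoly K l) * mon c2 k2 = mon (c1 * c2) (k1 + k2).
Proof. exact: lmulUU. Qed.

Lemma coef_outdom f k : k \notin msupp f -> coef f k = 0.
Proof. exact: mcoeff_outdom. Qed.

Local Opaque mon coef lmul.

Lemma monZ c1 c2 k : c1 *: (mon c2 k : lpoly K l) = mon (c1 * c2) k.
Proof. apply: lpolyP => k'; rewrite Defs.coefZ.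
transitivity (c1 * (c2 *+ (k == k'))); first by congr (_ * _); exact: coef_mon.
by rewrite mulrnAr; symmetry; exact: coef_mon.
Qed.

(** Exponents need to agree only under a nonzero coefficient: the truncated predecessor of a zero
    exponent of [y] always comes with coefficient zero. *)
Lemma eq_mon c1 c2 k1 k2 :
  c1 = c2 -> (c2 != 0 -> k1 = k2) -> mon c1 k1 = mon c2 k2 :> lpoly K l.
Proof.
by move=> ->; have [->|_ ->//] := eqVneq c2 0; rewrite !(@mon0 K l).
Qed.

Lemma eq_monD c1 c2 c1' c2' k1 k2 k1' k2' :
    c1 = c1' -> (c1' != 0 -> k1 = k1') -> c2 = c2' -> (c2' != 0 -> k2 = k2') ->
  mon c1 k1 + mon c2 k2 = mon c1' k1' + mon c2' k2' :> lpoly K l.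
Proof. by move=> cc kk cc' kk'; rewrite (eq_mon cc kk) (eq_mon cc' kk'). Qed.

(** Both partial derivatives have this shape. Cancellation may shrink the support of a sum, so the
    three sums are first extended to one common finite set, where the added terms vanish. *)
Lemma termwise_linear (F : int * nat -> K) (sh : int * nat -> int * nat) :
  linear (fun f => \sum_(k <- msupp f) mon (coef f k * F k) (sh k) : lpoly K l).
Proof.
have E f (d : {fset int * nat}) : (msupp f `<=` d)%fset ->
    \sum_(k <- msupp f) mon (coef f k * F k) (sh k)
      = \sum_(k <- d) mon (coef f k * F k) (sh k) :> lpoly K l.
  move=> le_d; apply/big_fset_incl => // k _ /coef_outdom ->.
  by rewrite mul0r mon0.
move=> c f g /=; pose d := (msupp (c *: f + g) `|` (msupp f `|` msupp g))%fset.
rewrite (E f d) ?(E g d) ?(E (c *: f + g) d) /d ?fsubsetUl //.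
- rewrite scaler_sumr -big_split /=; apply: eq_bigr => k _.
  by rewrite monZ -monD Defs.coefD Defs.coefZ; congr mon; ring.
- by rewrite fsubsetU // fsubsetUr orbT.
- by rewrite fsubsetU // fsubsetUl orbT.
Qed.

Lemma dy_termwise f :
  dy f = \sum_(k <- msupp f) mon (coef f k * k.2%:R) (k.1, k.2.-1).
Proof. by apply: eq_bigr => k _; rewrite mulr_natr. Qed.

Lemma dx_linear : linear (@dx K l).
Proof. exact: termwise_linear. Qed.

Lemma dy_linear : linear (@dy K l).
Proof. by move=> c f g; rewrite !dy_termwise termwise_linear. Qed.

HB.instance Definition _ :=
  GRing.isLinear.Build K (lpoly K l) (lpoly K l) _ (@dx K l) dx_linear.
HB.instance Definition _ :=
  GRing.isLinear.Build K (lpoly K l) (lpoly K l) _ (@dy K l) dy_linear.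

Lemma dx_mon c k :
  dx (mon c k : lpoly K l) = mon (c * (k.1%:~R / l%:R)) (k.1 - l%:Z, k.2).
Proof.
have [->|c0] := eqVneq c 0; first by rewrite mul0r !mon0 linear0.
by rewrite /dx msuppU (negPf c0) big_seq_fset1 coef_mon eqxx.
Qed.

Lemma dy_mon c k : dy (mon c k : lpoly K l) = mon (c *+ k.2) (k.1, k.2.-1).
Proof.
have [->|c0] := eqVneq c 0; first by rewrite mul0rn !mon0 linear0.
by rewrite /dy msuppU (negPf c0) big_seq_fset1 coef_mon eqxx.
Qed.

Lemma lpoly_ind (S : lpoly K l -> Prop) :
    S 0 -> (forall f g, S f -> S g -> S (f + g)) -> (forall c k, S (mon c k)) ->
  forall f, S f.
Proof. by move=> S0 SD Sm f; rewrite (lpolyE f); apply: big_ind. Qed.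

Lemma dxM f g : dx (f * g) = dx f * g + f * dx g.
Proof.
move: f g.
apply: (derivation_ind (D := @dx K l) (gen := fun f => exists c k, f = mon c k)).
  by move=> S S0 SD Sm; apply: lpoly_ind => // c k; apply: Sm; exists c, k.
move=> _ _ [c1 [[i1 j1] ->]] [c2 [[i2 j2] ->]] /=.
rewrite monM 3!dx_mon 2!monM /= intrD mulrDl mulrDr monD.
apply: eq_monD => [|_||_]; [by ring|..|by ring|]; congr pair => /=; ring.
Qed.

Lemma dyM f g : dy (f * g) = dy f * g + f * dy g.
Proof.
move: f g.
apply: (derivation_ind (D := @dy K l) (gen := fun f => exists c k, f = mon c k)).
  by move=> S S0 SD Sm; apply: lpoly_ind => // c k; apply: Sm; exists c, k.
move=> _ _ [c1 [[i1 j1] ->]] [c2 [[i2 j2] ->]] /=.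
rewrite monM 3!dy_mon 2!monM /= mulrnDr monD.
apply: eq_monD; rewrite ?mulrnAl ?mulrnAr //.
  by case: j1 => [|j1]; rewrite ?mulr0n ?eqxx //.
case: j2 => [|j2]; rewrite ?mulr0n ?eqxx // => _.
congr pair; change ((j1 + j2.+1)%N.-1 = (j1 + j2)%N).
by rewrite addnS.
Qed.

Lemma bracketDl f g P : bracket (f + g) P = bracket f P + bracket g P.
Proof. exact: (abstract_bracketDl (@dx K l) (@dy K l)). Qed.

Lemma bracketC f P : bracket f P = - bracket P f.
Proof. exact: (abstract_bracketC (@dx K l) (@dy K l)). Qed.

Lemma bracketDr f P Q : bracket f (P + Q) = bracket f P + bracket f Q.
Proof. exact: (abstract_bracketDr (@dx K l) (@dy K l)). Qed.

Lemma bracket_split f g f' g' :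
  bracket f g = bracket f' g' + (bracket f' (g - g') + bracket (f - f') g).
Proof. exact: (abstract_bracket_split (@dx K l) (@dy K l)). Qed.

Lemma bracketff f : bracket f f = 0.
Proof. exact: (abstract_bracketll (@dx K l) (@dy K l)). Qed.

Lemma bracketMl f g P : bracket (f * g) P = bracket f P * g + f * bracket g P.
Proof. exact: (abstract_bracketMl dxM dyM). Qed.

Lemma bracket0l P : bracket 0 P = 0.
Proof. exact: (abstract_bracket0l (@dx K l) (@dy K l)). Qed.

Lemma bracketZl c f P : bracket (c *: f) P = c *: bracket f P.
Proof.
have dxZ : dx (c *: f) = c *: dx f by exact: linearZ_LR.
have dyZ : dy (c *: f) = c *: dy f by exact: linearZ_LR.
by rewrite /bracket dxZ dyZ scalerBr (scalerAl c (dx f)) (scalerAl c (dy f)).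
Qed.

Lemma bracket_suml (I : Type) (r : seq I) (F : I -> lpoly K l) P :
  bracket (\sum_(i <- r) F i) P = \sum_(i <- r) bracket (F i) P.
Proof.
exact: (big_morph (bracket^~ P) (fun f g => bracketDl f g P) (bracket0l P)).
Qed.

Lemma bracket_sumr (I : Type) (r : seq I) (F : I -> lpoly K l) P :
  bracket P (\sum_(i <- r) F i) = \sum_(i <- r) bracket P (F i).
Proof.
have P0 : bracket P 0 = 0 by rewrite bracketC bracket0l oppr0.
exact: (big_morph (bracket P) (bracketDr P) P0).
Qed.

End BracketTheory.

(** * The bracket in terms of exponents *)

Section Shift.
Context {K : fieldType} {l : nat}.
Implicit Types (f g P : lpoly K l) (k z : int * nat) (c : K).

(** This is [l] times the cross product of the exponents, hence an integer. *)
Definition kcross k1 k2 : int := k1.1 * k2.2%:Z - k1.2%:Z * k2.1.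

(* The exponent shift of the bracket; truncated at exponent [0] of [y], where
   the bracket vanishes anyway. *)
Definition shift k : int * nat := (k.1 - l%:Z, k.2.-1).

Lemma monN c k : - (mon c k : lpoly K l) = mon (- c) k.
Proof. by rewrite -scaleN1r monZ mulN1r. Qed.

Lemma bracket_mon c1 c2 k1 k2 :
  bracket (mon c1 k1) (mon c2 k2 : lpoly K l)
    = mon (c1 * c2 * ((kcross k1 k2)%:~R / l%:R)) (shift (k1 + k2)).
Proof.
case: k1 k2 => [i1 j1] [i2 j2]; rewrite /bracket 2!dx_mon 2!dy_mon 2!monM monN.
rewrite /kcross /= intrD mulrDl mulrDr monD; apply: eq_monD.
- by rewrite intrM -mulr_natr -pmulrn; ring.
- case: j2 => [|j2]; first by rewrite mulr0 !mul0r mulr0 eqxx.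
  move=> _; rewrite /shift; congr pair => /=; first by ring.
  by change ((j1 + j2)%N = (j1 + j2.+1)%N.-1); rewrite addnS.
- by rewrite intrN intrM -mulr_natr -pmulrn; ring.
- case: j1 => [|j1]; first by rewrite mul0r (_ : (- 0)%:~R = 0) // mul0r mulr0 eqxx.
  by move=> _; rewrite /shift; congr pair => /=; ring.
Qed.

Lemma bracketE f g :
  bracket f g = \sum_(k1 <- msupp f) \sum_(k2 <- msupp g)
    mon (coef f k1 * coef g k2 * ((kcross k1 k2)%:~R / l%:R)) (shift (k1 + k2)).
Proof.
rewrite {1}(lpolyE f) bracket_suml; apply: eq_bigr => k1 _.
rewrite {1}(lpolyE g) bracket_sumr; apply: eq_bigr => k2 _.
exact: bracket_mon.
Qed.

Lemma msupp_bracket f g z : z \in msupp (bracket f g) ->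
  exists k1 k2, [/\ k1 \in msupp f, k2 \in msupp g, kcross k1 k2 != 0
    & z = shift (k1 + k2)].
Proof.
rewrite coef_neq0 => z0; apply: contrapT => H; case/eqP: z0.
rewrite bracketE lcoef_sum big1_seq // => k1 /andP[_ k1f].
rewrite lcoef_sum big1_seq // => k2 /andP[_ k2g]; rewrite coef_mon.
case: eqP => [zE|_]; last exact: mulr0n.
have [->|k0] := eqVneq (kcross k1 k2) 0; first by rewrite mul0r mulr0 mul0rn.
by case: H; exists k1, k2.
Qed.

Lemma coef_supp_sum f (C : pred (int * nat)) k :
  coef (\sum_(k' <- msupp f | C k') mon (coef f k') k' : lpoly K l) k
    = if C k then coef f k else 0.
Proof.
rewrite lcoef_sum; have [kf|kf] := boolP (k \in msupp f); last first.
  rewrite (coef_outdom kf) if_same big1_seq // => k' /andP[_ k'f].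
  rewrite coef_mon; case: eqP => [E|_]; last exact: mulr0n.
  by rewrite E (negPf kf) in k'f.
rewrite big_mkcond (bigD1_seq k kf (fset_uniq _)) /= coef_mon eqxx mulr1n.
rewrite big1 ?addr0 // => k' k'k.
by rewrite coef_mon (negPf k'k) mulr0n if_same.
Qed.

Lemma msupp_supp_sum f (C : pred (int * nat)) k :
  (k \in msupp (\sum_(k' <- msupp f | C k') mon (coef f k') k' : lpoly K l))
    = C k && (k \in msupp f).
Proof. by rewrite !coef_neq0 coef_supp_sum; case: (C k); rewrite ?eqxx. Qed.
End Shift.

(** * Coordinates of the plane adapted to a direction *)

Section Points.
Implicit Types (u : int * int) (p q r : rat * rat) (eps s : rat).

Definition wcross u p : rat := cross (u.1%:~R, u.2%:~R) p.

(** Degree first, then position along the line of constant degree, oriented by the sign of [eps].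
    For nonzero [eps] and a direction [u] this is a total order compatible with addition, so its
    maxima are vertices of the Newton polygon. *)
Definition lexle eps u p q : Prop :=
  vpt u p < vpt u q \/ vpt u p = vpt u q /\ eps * wcross u p <= eps * wcross u q.

Lemma vptD u p q : vpt u (p + q) = vpt u p + vpt u q.
Proof. by rewrite /vpt /=; ring. Qed.

Lemma vptB u p q : vpt u (p - q) = vpt u p - vpt u q.
Proof. by rewrite /vpt /=; ring. Qed.

Lemma vptZ u s p : vpt u (scale_pt s p) = s * vpt u p.
Proof. by rewrite /vpt /=; ring. Qed.

Lemma wcrossD u p q : wcross u (p + q) = wcross u p + wcross u q.
Proof. by rewrite /wcross /cross /=; ring. Qed.

Lemma wcrossB u p q : wcross u (p - q) = wcross u p - wcross u q.
Proof. by rewrite /wcross /cross /=; ring. Qed.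

Lemma wcrossZ u s p : wcross u (scale_pt s p) = s * wcross u p.
Proof. by rewrite /wcross /cross /=; ring. Qed.

Lemma direction_norm_rat u : direction u ->
  0 < u.1%:~R * u.1%:~R + u.2%:~R * u.2%:~R :> rat.
Proof.
by move=> /direction_norm_gt0; rewrite -!intrM -intrD ltr0z.
Qed.

(** [vpt u] and [wcross u] are linear coordinates on the plane, with determinant |u|^2. *)
Lemma point_eq u p q : direction u ->
  vpt u p = vpt u q -> wcross u p = wcross u q -> p = q.
Proof.
move=> /direction_norm_rat n0; rewrite /vpt /wcross /cross /=.
case: p q => [p1 p2] [q1 q2] /=; set a := u.1%:~R; set b := u.2%:~R => E1 E2.
have F1 : (a * a + b * b) * p1 = (a * a + b * b) * q1.
  rewrite (_ : _ * p1 = a * (a * p1 + b * p2) - b * (a * p2 - b * p1)); last by ring.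
  by rewrite E1 E2; ring.
have F2 : (a * a + b * b) * p2 = (a * a + b * b) * q2.
  rewrite (_ : _ * p2 = b * (a * p1 + b * p2) + a * (a * p2 - b * p1)); last by ring.
  by rewrite E1 E2; ring.
have nz := lt0r_neq0 n0.
by rewrite (mulfI nz F1) (mulfI nz F2).
Qed.

Lemma lexle_anti eps u p q : direction u -> eps != 0 ->
  lexle eps u p q -> lexle eps u q p -> p = q.
Proof.
move=> ud e0 [lt1|[E1 l1]] [lt2|[E2 l2]];
  try by exfalso; lra.
apply: (point_eq ud E1); apply: (mulfI e0); lra.
Qed.

(** The maximum of a sum of two sets is reached by a single pair. *)
Lemma lexle_add_eq eps u p q p' q' : direction u -> eps != 0 ->
  lexle eps u p p' -> lexle eps u q q' -> p + q = p' + q' -> p = p' /\ q = q'.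
Proof.
move=> ud e0 lp lq E.
have EV : vpt u p + vpt u q = vpt u p' + vpt u q' by rewrite -!vptD E.
have EW : eps * wcross u p + eps * wcross u q = eps * wcross u p' + eps * wcross u q'.
  by rewrite -!mulrDr -!wcrossD E.
split.
- by apply: (lexle_anti ud e0 lp); move: lp lq => [?|[? ?]] [?|[? ?]];
    [left|left|left|right]; lra.
- by apply: (lexle_anti ud e0 lq); move: lp lq => [?|[? ?]] [?|[? ?]];
    [left|left|left|right]; lra.
Qed.

Lemma proportional u s p q : cross p q = 0 -> vpt u q != 0 ->
  vpt u p = s * vpt u q -> p = scale_pt s q.
Proof.
rewrite /cross /vpt /scale_pt; case: p q => [p1 p2] [q1 q2] /=.
set a := u.1%:~R; set b := u.2%:~R => E V0 EV.
congr pair; apply: (mulfI V0).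
  rewrite [LHS](_ : _ = q1 * (a * p1 + b * p2) + b * (p1 * q2 - p2 * q1)); last by ring.
  by rewrite E EV; ring.
rewrite [LHS](_ : _ = q2 * (a * p1 + b * p2) - a * (p1 * q2 - p2 * q1)); last by ring.
by rewrite E EV; ring.
Qed.

Lemma seq_lexmax (T : eqType) (F G : T -> rat) (r : seq T) : r != [::] ->
  exists2 x, x \in r & forall y, y \in r -> F y < F x \/ F y = F x /\ G y <= G x.
Proof.
elim: r => // x r IHr _; have [->|/IHr [m mr maxm]] := eqVneq r [::].
  by exists x; rewrite ?mem_head // => y; rewrite inE => /eqP ->; right.
have [xm|xm] : (F m < F x \/ F m = F x /\ G m <= G x) \/
    (F x < F m \/ F x = F m /\ G x <= G m).
- case: (ltrgtP (F m) (F x)) => H; [by left; left|by right; left|].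
  by case/orP: (le_total (G m) (G x)) => ?; [left|right]; right.
- exists x; rewrite ?mem_head // => y; rewrite inE => /orP[/eqP ->|/maxm]; [by right|].
  by move: xm => [?|[? ?]] [?|[? ?]]; [left|left|left|right]; lra.
exists m; rewrite ?inE ?mr ?orbT // => y; rewrite inE => /orP[/eqP ->//|]; exact: maxm.
Qed.

End Points.

(** * Extreme exponents and leading forms of brackets *)

Section LexMax.
Context {K : fieldType} {l : nat}.
Hypotheses (charK : [pchar K] =i pred0) (l_gt0 : (0 < l)%N).
Local Notation ex := (@expo l).
Local Notation sh := (@shift l).
Implicit Types (f g P : lpoly K l) (k z : int * nat) (u : int * int) (eps : rat).

(* For [eps = 1] this is the end point, for [eps = -1] the starting point, of
   the leading form of [f] in direction [u]. *)
Definition lexmax eps u f k : Prop :=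
  k \in msupp f /\
  forall k', k' \in msupp f -> lexle eps u (ex k') (ex k).

Let l_neq0 : l%:R != 0 :> rat. Proof. by rewrite pnatr_eq0 -lt0n. Qed.

Lemma expo_inj : injective ex.
Proof.
move=> [i j] [i' j'] [/(mulIf (invr_neq0 l_neq0))/eqP + /eqP].
by rewrite eqr_int eqr_nat => /eqP -> /eqP ->.
Qed.

Lemma expoD k1 k2 : ex (k1 + k2) = ex k1 + ex k2.
Proof. by rewrite /expo /= intrD natrD mulrDl. Qed.

Lemma cross_expo k1 k2 :
  (cross (ex k1) (ex k2) == 0) = (kcross k1 k2 == 0).
Proof.
have -> : cross (ex k1) (ex k2) = (kcross k1 k2)%:~R / l%:R.
  by rewrite /cross /kcross /= intrB !intrM; field.
by rewrite mulf_eq0 invr_eq0 (negPf l_neq0) orbF intr_eq0.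
Qed.

(** Hence for pairs contributing to a bracket the truncated predecessor in [shift] is a true
    subtraction. *)
Lemma kcross_y k1 k2 : kcross k1 k2 != 0 -> (0 < (k1 + k2)%R.2)%N.
Proof.
case: k1 k2 => [i1 j1] [i2 j2]; rewrite /kcross /= => H.
change (0 < j1 + j2)%N; rewrite addn_gt0 !lt0n.
apply: contraNT H; rewrite negb_or !negbK => /andP[/eqP -> /eqP ->].
by rewrite mulr0 mul0r.
Qed.

Lemma expo_shift k1 k2 : kcross k1 k2 != 0 ->
  ex (sh (k1 + k2)) = ex k1 + ex k2 - (1, 1).
Proof.
move=> /kcross_y H; rewrite -expoD /expo /shift /=; congr pair.
  by rewrite intrB mulrBl /=; congr (_ - _); rewrite divff.
by rewrite -subn1 natrB.
Qed.

Lemma lexmax_exists eps u f : f != 0 -> exists k, lexmax eps u f k.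
Proof.
move=> f0; have sf : (msupp f : seq _) != [::].
  by apply: contraNneq f0 => sf; rewrite (lpolyE f) sf big_nil.
have [k kf maxk] := seq_lexmax (fun k => vpt u (ex k))
  (fun k => eps * wcross u (ex k)) sf.
by exists k.
Qed.

Lemma lexmax_expo eps u f k k' : direction u -> eps != 0 ->
  lexmax eps u f k -> lexmax eps u f k' -> ex k = ex k'.
Proof.
move=> ud e0 [kf maxk] [k'f maxk'].
exact: (lexle_anti ud e0 (maxk' _ kf) (maxk _ k'f)).
Qed.

Lemma lexmax_neq0 eps u f k : lexmax eps u f k -> f != 0.
Proof. by case=> + _; apply: contraTneq => ->; rewrite coef_neq0 coef0 eqxx. Qed.

Lemma intr_char0_eq0 (z : int) : (z%:~R == 0 :> K) = (z == 0).
Proof.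
have /pcharf0P charK0 := charK.
by case: z => n; rewrite ?NegzE ?intrN ?oppr_eq0 -pmulrn charK0.
Qed.

(** Only the pair of extreme exponents contributes to the coefficient at their shifted sum. That
    coefficient is [kcross k1 k2] times a nonzero factor, and characteristic zero keeps a nonzero
    integer nonzero in [K]. *)
Lemma bracket0_kcross eps u f g k1 k2 : direction u -> eps != 0 ->
  lexmax eps u f k1 -> lexmax eps u g k2 -> bracket f g = 0 -> kcross k1 k2 = 0.
Proof.
move=> ud e0 [k1f max1] [k2g max2] fg0; apply/eqP/negPn/negP => k12.
have : coef (bracket f g) (sh (k1 + k2)) = 0 by rewrite fg0 coef0.
rewrite bracketE lcoef_sum (bigD1_seq k1 k1f (fset_uniq _)) /=.
have E k1' k2' : k1' \in msupp f -> k2' \in msupp g -> (k1', k2') != (k1, k2) ->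
    coef (mon (coef f k1' * coef g k2' * ((kcross k1' k2')%:~R / l%:R))
      (sh (k1' + k2')) : lpoly K l) (sh (k1 + k2)) = 0.
  move=> k1f' k2g' kk; rewrite coef_mon.
  have [->|k12'] := eqVneq (kcross k1' k2') 0; first by rewrite mul0r mulr0 mul0rn.
  case: eqP => [zE|_]; last exact: mulr0n.
  have : ex k1' + ex k2' = ex k1 + ex k2.
    by apply: (addIr (- (1, 1))); rewrite -!expo_shift // zE.
  case/(lexle_add_eq ud e0 (max1 _ k1f') (max2 _ k2g')) => /expo_inj E1 /expo_inj E2.
  by rewrite E1 E2 eqxx in kk.
rewrite [X in _ + X]big1_seq ?addr0; last first.
  move=> k1' /andP[k1k k1f']; rewrite lcoef_sum big1_seq // => k2' /andP[_ k2g'].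
  by apply: E => //; apply: contraNneq k1k => -[-> _].
rewrite lcoef_sum (bigD1_seq k2 k2g (fset_uniq _)) /= big1_seq ?addr0; last first.
  move=> k2' /andP[k2k k2g']; apply: E => //.
  by apply: contraNneq k2k => -[->].
rewrite coef_mon eqxx mulr1n; apply/eqP.
have /pcharf0P charK0 := charK.
by rewrite !mulf_neq0 ?invr_eq0 ?intr_char0_eq0 ?charK0 -?lt0n -?coef_neq0.
Qed.

Lemma lexmax_vdeg eps u f k : lexmax eps u f k -> vdeg u f = (vpt u (ex k))%:E.
Proof.
move=> [kf maxk]; rewrite /vdeg; apply/le_anti/andP; split.
  rewrite /Supp big_map big_seq; elim/big_ind: _ => [|x y xk yk|k' /maxk k'k].
  - exact: leNye.
  - by rewrite ge_max xk yk.
  by rewrite lee_fin; case: k'k => [/ltW //|[->]].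
by rewrite /Supp big_map (big_rem k kf) /= le_max lexx.
Qed.

Lemma msupp_ell eps u f k k' : lexmax eps u f k ->
  (k' \in msupp (ell u f)) =
    (vpt u (ex k') == vpt u (ex k)) && (k' \in msupp f).
Proof.
by move=> fk; rewrite /ell msupp_supp_sum (lexmax_vdeg fk).
Qed.

Lemma lexmax_ell eps u f k : lexmax eps u f k -> lexmax eps u (ell u f) k.
Proof.
move=> fk; have [kf maxk] := fk; split; first by rewrite (msupp_ell _ fk) eqxx.
by move=> k'; rewrite (msupp_ell _ fk) => /andP[_ /maxk].
Qed.

Lemma top_pair u f g k1 k2 e1 e2 eps : lexmax eps u f e1 -> lexmax eps u g e2 ->
  k1 \in msupp f -> k2 \in msupp g ->
  vpt u (ex e1) + vpt u (ex e2) <= vpt u (ex k1) + vpt u (ex k2) ->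
  k1 \in msupp (ell u f) /\ k2 \in msupp (ell u g).
Proof.
move=> fe ge k1f k2g; rewrite (msupp_ell _ fe) (msupp_ell _ ge) k1f k2g !andbT.
have [_ /(_ _ k1f) l1] := fe; have [_ /(_ _ k2g) l2] := ge.
by move: l1 l2 => [?|[-> _]] [?|[-> _]] ?; split; rewrite ?eqxx //; exfalso; lra.
Qed.

(** Every exponent of the bracket of the leading forms has the largest degree that [bracket f g] can
    reach, and the lower terms of [f] and [g] cannot cancel it. *)
Lemma bracket_ell_neq0 eps u f g e1 e2 :
    lexmax eps u f e1 -> lexmax eps u g e2 ->
    bracket (ell u f) (ell u g) != 0 -> exists2 z, z \in msupp (bracket f g) &
    vpt u (ex z) = vpt u (ex e1) + vpt u (ex e2) - vpt u (1, 1).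
Proof.
move=> fe ge nz.
have [z [zin _]] := lexmax_exists eps u nz; exists z; last first.
  have [k1 [k2 [+ + k12 ->]]] := msupp_bracket zin.
  rewrite (msupp_ell _ fe) (msupp_ell _ ge) => /andP[/eqP <- _] /andP[/eqP <- _].
  by rewrite expo_shift // vptB vptD.
have low (h : lpoly K l) e k : lexmax eps u h e -> k \in msupp (h - ell u h) ->
    k \in msupp h /\ vpt u (ex k) != vpt u (ex e).
  move=> he; rewrite !coef_neq0 Defs.coefD lcoefN /ell coef_supp_sum.
  rewrite (lexmax_vdeg he) eqe; case: ifP => _; first by rewrite subrr eqxx.
  by rewrite subr0.
(* A pair outside the leading forms falls short of the degree of [z]; this disposes of both
   remainder terms of [bracket_split]. *)
have out (h1 h2 : lpoly K l) : (forall k1 k2, k1 \in msupp h1 -> k2 \in msupp h2 ->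
      [/\ k1 \in msupp f, k2 \in msupp g &
       ~~ ((k1 \in msupp (ell u f)) && (k2 \in msupp (ell u g)))]) ->
    coef (bracket h1 h2) z = 0.
  move=> H; apply: coef_outdom; apply/negP => /msupp_bracket[j1 [j2 [+ + j12 zE]]].
  move=> j1h j2h; have [j1f j2g /negP []] := H _ _ j1h j2h; apply/andP.
  apply: (top_pair fe ge) => //.
  have [k1 [k2 [+ + k12 zE']]] := msupp_bracket zin.
  rewrite (msupp_ell _ fe) (msupp_ell _ ge) => /andP[/eqP <- _] /andP[/eqP <- _].
  have : vpt u (ex z) = vpt u (ex (sh (j1 + j2))) by rewrite -zE.
  rewrite zE' !expo_shift // !vptB !vptD.
  by lra.
have E1 : coef (bracket (ell u f) (g - ell u g)) z = 0.
  apply: out => k1 k2; rewrite (msupp_ell _ fe) => /andP[_ k1f].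
  move=> /(low _ _ _ ge)[k2g k2V]; split=> //.
  by rewrite (msupp_ell _ ge) (negPf k2V) andbF.
have E2 : coef (bracket (f - ell u f) g) z = 0.
  apply: out => k1 k2 /(low _ _ _ fe)[k1f k1V] k2g; split=> //.
  by rewrite (msupp_ell _ fe) (negPf k1V).
have E := etrans (Defs.coefD _ _ _) (congr2 +%R E1 E2).
have {}E := etrans (Defs.coefD (bracket (ell u f) (ell u g)) _ z) (congr2 +%R erefl E).
rewrite coef_neq0 (congr1 (fun h => coef h z) (bracket_split f g (ell u f) (ell u g))).
by rewrite E addr0 addr0 -coef_neq0.
Qed.

(** By [bracket_ell_neq0] the degree of [e3] is the largest possible, and only pairs from the two
    leading forms attain it. *)
Lemma lexmax_bracket eps u f g e1 e2 e3 :
    lexmax eps u f e1 -> lexmax eps u g e2 ->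
    bracket (ell u f) (ell u g) != 0 -> lexmax eps u (bracket f g) e3 ->
  exists k1 k2, [/\ k1 \in msupp (ell u f), k2 \in msupp (ell u g),
    kcross k1 k2 != 0 & e3 = sh (k1 + k2)].
Proof.
move=> fe ge nz [e3in max3].
have [k1 [k2 [k1f k2g k12 e3E]]] := msupp_bracket e3in.
exists k1, k2; suff [k1l k2l] : k1 \in msupp (ell u f) /\ k2 \in msupp (ell u g) by [].
apply: (top_pair fe ge k1f k2g).
have [z zin zV] := bracket_ell_neq0 fe ge nz.
have e3V : vpt u (ex e3) = vpt u (ex k1) + vpt u (ex k2) - vpt u (1, 1).
  by rewrite e3E expo_shift // vptB vptD.
by have [?|[? _]] := max3 _ zin; lra.
Qed.

(** * Start and end points as lexicographic maxima *)

Section StEn.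
Variables (u : int * int) (f : lpoly K l) (ks ke : int * nat).
Hypotheses (ud : direction u) (fs : lexmax (-1) u f ks) (fe : lexmax 1 u f ke).

Let bounds p : p \in Supp (ell u f) -> [/\ vpt u p = vpt u (ex ks),
  wcross u (ex ks) <= wcross u p & wcross u p <= wcross u (ex ke)].
Proof.
case/mapP=> k; rewrite (msupp_ell _ fe) => /andP[/eqP kV kf ->].
have [ksf /(_ _ kf) maxs] := fs; have [kef /(_ _ kf) maxe] := fe.
have [_ /(_ _ kef) sV] := fs; have [_ /(_ _ ksf) eV] := fe.
by move: maxs maxe sV eV => [?|[? ?]] [?|[? ?]] [?|[? ?]] [?|[? ?]]; split; lra.
Qed.

Let ks_Supp : ex ks \in Supp (ell u f).
Proof. by apply: map_f; have [] := lexmax_ell fs. Qed.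

Let ke_Supp : ex ke \in Supp (ell u f).
Proof. by apply: map_f; have [] := lexmax_ell fe. Qed.

Lemma is_st_en_lexmax : is_st_en u f (ex ks) (ex ke).
Proof.
split=> // [p pS|].
  have [pV ps pe] := bounds pS; have [eV _ _] := bounds ke_Supp.
  have [es|es] := eqVneq (wcross u (ex ke)) (wcross u (ex ks)).
    exists 0; first by rewrite lexx ler01.
    apply: (point_eq ud); rewrite ?vptD ?wcrossD ?vptZ ?wcrossZ ?pV ?mul0r ?addr0 //.
    by lra.
  have d_gt0 : 0 < wcross u (ex ke) - wcross u (ex ks) by lra.
  (* On the edge the degree is constant, so [wcross u] alone gives the relative position of [p]. *)
  exists ((wcross u p - wcross u (ex ks)) / (wcross u (ex ke) - wcross u (ex ks))).
    rewrite divr_ge0 ?ler_pdivrMr //; lra.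
  apply: (point_eq ud); rewrite ?vptD ?wcrossD ?vptZ ?wcrossZ ?vptB ?wcrossB.
    by rewrite pV eV subrr mulr0 addr0.
  by rewrite divfK ?lt0r_neq0 //; lra.
move=> S1; rewrite -[X in 0 < X]/(wcross u (ex ke - ex ks)) wcrossB.
have [_ _ se] := bounds ks_Supp; rewrite subr_gt0 lt_neqAle se andbT.
apply: contraL S1 => /eqP es; rewrite -leqNgt.
apply: (@uniq_leq_size _ (Supp (ell u f)) [:: ex ks]).
  by rewrite map_inj_uniq; [exact: fset_uniq|exact: expo_inj].
move=> p pS; have [pV ps pe] := bounds pS; rewrite inE; apply/eqP.
by apply: (point_eq ud) => //; lra.
Qed.

(** [en] rests on a choice, so every pair meeting the specification must have this end. As [ex ke]
    lies on the segment from [s] to [e], it is not past [e], while its maximality gives the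
    converse. *)
Lemma en_lexmax : en u f = ex ke.
Proof.
rewrite /en /st_en; set A := [set se | _]%classic.
have /(xgetPex (0, 0)) : exists x, A x by exists (ex ks, ex ke); exact: is_st_en_lexmax.
rewrite -/A; case: (xget (0, 0) A) => s e [/= sS eS seg cr].
have [eV _ ee] := bounds eS; have [keV _ _] := bounds ke_Supp.
apply: (point_eq ud) => /=; first by rewrite eV keV.
have [t t01 keE] := seg _ ke_Supp.
have [S1|S1] := ltnP 1 (size (Supp (ell u f))).
  have := cr S1; rewrite -[X in 0 < X]/(wcross u (e - s)) wcrossB => d_gt0.
  have : wcross u (ex ke) = wcross u s + t * (wcross u e - wcross u s).
    by rewrite {1}keE wcrossD wcrossZ wcrossB.
  by nra.
have : e = ex ke; last by move=> ->.
by case: (Supp (ell u f)) S1 eS ke_Supp => [|x []] //= _; rewrite !inE => /eqP -> /eqP ->.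
Qed.

End StEn.

End LexMax.

(** * Propagation of proportionality from one direction to the next *)

Section Propagation.
Context {K : fieldType} {l : nat}.
Hypotheses (charK : [pchar K] =i pred0) (l_gt0 : (0 < l)%N).
Local Notation ex := (@expo l).
Implicit Types (f T P : lpoly K l) (k : int * nat) (u d w : int * int).

Let l_gt0_rat : 0 < l%:R :> rat. Proof. by rewrite ltr0n. Qed.

(** Multiply the strict inequality by the positive degree [a x + b y] and eliminate [c] with the
    equation: what remains is |u|^2 (y - x) < 0. *)
Lemma above_diagonal_contra (a b x y c : rat) : 0 < a * a + b * b ->
    0 < a * x + b * y -> c * (a * x + b * y) = a + b ->
    c * (a * y - b * x) < a - b -> x < y -> False.
Proof.
move=> n0 V0 cV cW xy.
have : 0 < (a - b - c * (a * y - b * x)) * (a * x + b * y).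
  by rewrite mulr_gt0 // subr_gt0.
have -> : (a - b - c * (a * y - b * x)) * (a * x + b * y)
    = (a - b) * (a * x + b * y) - c * (a * x + b * y) * (a * y - b * x) by ring.
rewrite cV; have -> : (a - b) * (a * x + b * y) - (a + b) * (a * y - b * x)
    = - ((a * a + b * b) * (y - x)) by ring.
by rewrite oppr_gt0 ltNge mulr_ge0 ?subr_ge0 // ltW.
Qed.

(* If the bracket did not vanish, it would be [ell u (bracket f P)], whose
   starting point is both on the line of that of [P] and past the point that
   the starting points of [f] and [P] give; this forces the starting point of
   [P] to lie below the diagonal. *)
Lemma bracket_ell_eq0 u f P kP kf (s s' : rat) : direction u ->
    lexmax (-1) u P kP -> lexmax (-1) u f kf -> ex kf = scale_pt s (ex kP) ->
    (forall k, lexmax (-1) u (bracket f P) k -> ex k = scale_pt s' (ex kP)) ->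
    0 < vpt u (ex kP) -> (ex kP).1 < (ex kP).2 ->
  bracket (ell u f) (ell u P) = 0.
Proof.
move=> ud Pk fk kfE brE V0 xy; apply/eqP/negPn/negP => nz.
have [z zin _] := bracket_ell_neq0 l_gt0 fk Pk nz.
have br0 : bracket f P != 0.
  by apply: contraTneq zin => ->; rewrite coef_neq0 coef0 eqxx.
have [k3 k3max] := lexmax_exists (-1) u br0.
have [k1 [k2 [k1f k2P k12 k3E]]] := lexmax_bracket l_gt0 fk Pk nz k3max.
have ex3 : ex k3 = ex k1 + ex k2 - (1, 1) by rewrite k3E expo_shift.
rewrite (brE _ k3max) in ex3.
have := k1f; rewrite (msupp_ell _ fk) => /andP[/eqP V1 /(proj2 fk) W1].
have := k2P; rewrite (msupp_ell _ Pk) => /andP[/eqP V2 /(proj2 Pk) W2].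
have {}W1 : wcross u (ex kf) <= wcross u (ex k1) by move: W1 => [?|[_ ?]]; lra.
have {}W2 : wcross u (ex kP) <= wcross u (ex k2) by move: W2 => [?|[_ ?]]; lra.
(* Equality would force [k1 = kf] and [k2 = kP]; these are proportional, so their [kcross] would be
   zero. *)
have W12 : wcross u (ex kf) + wcross u (ex kP) < wcross u (ex k1) + wcross u (ex k2).
  rewrite lt_neqAle lerD // andbT; apply: contraNneq k12 => W.
  have -> : k1 = kf by apply/(expo_inj l_gt0)/(point_eq ud); lra.
  have -> : k2 = kP by apply/(expo_inj l_gt0)/(point_eq ud); lra.
  rewrite -(cross_expo l_gt0) kfE /cross /scale_pt /=; apply/eqP; ring.
have EV := congr1 (vpt u) ex3; have EW := congr1 (wcross u) ex3.
rewrite !vptB !vptD vptZ V1 V2 kfE vptZ in EV.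
rewrite !wcrossB !wcrossD wcrossZ in EW.
rewrite kfE wcrossZ in W12.
have V11 : vpt u (1, 1) = u.1%:~R + u.2%:~R by rewrite /vpt /=; ring.
have W11 : wcross u (1, 1) = u.1%:~R - u.2%:~R by rewrite /wcross /cross /=; ring.
(* The constant [s + 1 - s'] comes from moving all multiples of [ex kP] in [ex3] to one side. *)
have cV : (s + 1 - s') * vpt u (ex kP) = u.1%:~R + u.2%:~R by lra.
have cW : (s + 1 - s') * wcross u (ex kP) < u.1%:~R - u.2%:~R by lra.
exact: (above_diagonal_contra (direction_norm_rat ud) V0 cV cW xy).
Qed.

Lemma vpt_sub_expo u k k' : vpt u (ex k) - vpt u (ex k')
  = (u.1 * (k.1 - k'.1) + u.2 * (l%:Z * (k.2%:Z - k'.2%:Z)))%:~R / l%:R.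
Proof.
rewrite /vpt /expo /= intrD !intrM !intrB -!pmulrn; field.
exact: lt0r_neq0.
Qed.

(** The primitive normal of the segment from [k'] to [k]: the difference of the exponents, made
    integral by the factor [l] and turned clockwise by a right angle. *)
Definition edge_dir k k' : int * int :=
  primitive (l%:Z * (k.2%:Z - k'.2%:Z), - (k.1 - k'.1)).

(** The difference [ex k - ex k'] has negative degree in direction [d] and positive degree in
    direction [u], so between them lies a direction in which its degree is zero. *)
Lemma edge_dir_between d u f k k' : direction d -> direction u -> 0 < cross d u ->
    lexmax 1 d f k' -> lexmax (-1) u f k -> k != k' ->
  [/\ direction (edge_dir k k'), 0 < cross d (edge_dir k k')
    & 0 < cross (edge_dir k k') u].
Proof.
move=> dd ud du [k'f maxd] [kf maxu] kk'.
have du_rat : 0 < d.1%:~R * u.2%:~R - d.2%:~R * u.1%:~R :> rat.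
  by rewrite -!intrM -intrB ltr0z.
have change_dir v w p : vpt w p * (v.1%:~R * v.1%:~R + v.2%:~R * v.2%:~R)
    = vpt v p * (v.1%:~R * w.1%:~R + v.2%:~R * w.2%:~R)
      + wcross v p * (v.1%:~R * w.2%:~R - v.2%:~R * w.1%:~R).
  by rewrite /vpt /wcross /cross /=; ring.
have W0 w : direction w -> vpt w (ex k - ex k') = 0 -> wcross w (ex k - ex k') != 0.
  rewrite vptB wcrossB subr_eq0 => wd /eqP; rewrite subr_eq0 => /eqP V.
  by apply: contraNneq kk' => W; apply/eqP/(expo_inj l_gt0)/(point_eq wd).
have [Vd0 Wd0] : vpt d (ex k - ex k') <= 0 /\
    (vpt d (ex k - ex k') = 0 -> wcross d (ex k - ex k') <= 0).
  by rewrite vptB wcrossB; case: (maxd k kf) => [?|[? ?]]; split=> *; lra.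
have [Vu0 Wu0] : 0 <= vpt u (ex k - ex k') /\
    (vpt u (ex k - ex k') = 0 -> wcross u (ex k - ex k') <= 0).
  by rewrite vptB wcrossB; case: (maxu k' k'f) => [?|[? ?]]; split=> *; lra.
have nd := direction_norm_rat dd; have nu := direction_norm_rat ud.
(* Were the degree in [d] zero, the end point condition would make [wcross d] negative, and turning
   towards [u] would make the degree in [u] negative. [Vu] is symmetric. *)
have Vd : vpt d (ex k - ex k') < 0.
  rewrite lt_neqAle Vd0 andbT; apply/eqP => V.
  have := change_dir d u (ex k - ex k'); rewrite V mul0r add0r.
  have W : wcross d (ex k - ex k') < 0 by rewrite lt_neqAle W0 // Wd0.
  apply/eqP; rewrite gt_eqF //; apply: lt_le_trans (_ : 0 <= _).
    by rewrite nmulr_rlt0.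
  by rewrite mulr_ge0 // ltW.
have Vu : 0 < vpt u (ex k - ex k').
  rewrite lt_neqAle Vu0 andbT eq_sym; apply/eqP => V.
  have := change_dir u d (ex k - ex k'); rewrite V mul0r add0r.
  have W : wcross u (ex k - ex k') < 0 by rewrite lt_neqAle W0 // Wu0.
  apply/eqP; rewrite lt_eqF //; apply: le_lt_trans (_ : _ <= 0) _.
    by rewrite mulr_le0_ge0 // ltW.
  by rewrite nmulr_rgt0 //; lra.
rewrite vptB vpt_sub_expo pmulr_llt0 ?invr_gt0 // ltrz0 in Vd.
rewrite vptB vpt_sub_expo pmulr_lgt0 ?invr_gt0 // ltr0z in Vu.
set p := k.1 - k'.1 in Vd Vu *; set q := l%:Z * _ in Vd Vu *.
have [|wd [g g0 [/= Eq Ep]]] := @primitiveP (q, - p).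
  by apply/orP; apply: contraTT Vd => /norP[/negPn/eqP /= -> /negPn/eqP /= Np];
    rewrite -(opprK p) Np oppr0 !mulr0.
rewrite -/(edge_dir k k') in wd Eq Ep *; set w := edge_dir k k' in wd Eq Ep *.
split=> //; rewrite -(pmulr_lgt0 _ g0).
  have -> : cross d w * g = d.1 * (w.2 * g) - d.2 * (w.1 * g) by rewrite /cross; ring.
  by rewrite -Ep -Eq mulrN -opprD oppr_gt0.
have -> : cross w u * g = u.2 * (w.1 * g) - u.1 * (w.2 * g) by rewrite /cross; ring.
by rewrite -Ep -Eq mulrN opprK addrC.
Qed.

Variables (P : lpoly K l) (A B : int * int) (kA : int * nat).
Hypotheses (Ad : direction A) (A_ge0 : 0 <= A.1 + A.2) (Bd : direction B).
Hypothesis AB : ccw_lt A B (0, -1).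
Hypothesis P_gt0 : forall w, direction w -> ccw_le A A w -> ccw_le A w B ->
  (0 < vdeg w P)%E.
Hypothesis P_kA : lexmax 1 A P kA.
Hypothesis kA_above : (ex kA).1 < (ex kA).2.

Let P_neq0 : P != 0. Proof. exact: lexmax_neq0 P_kA. Qed.

Definition in_range u := [/\ direction u, ccw_lt A A u & ccw_le A u B].

Lemma in_range_gt0 u eps k : in_range u -> lexmax eps u P k -> 0 < vpt u (ex k).
Proof.
move=> [ud Au uB] Pk; have := P_gt0 ud _ uB.
by rewrite (lexmax_vdeg Pk) lte_fin; apply; rewrite /ccw_le Au orbT.
Qed.

Lemma start_above_diagonal u k : in_range u -> lexmax (-1) u P k ->
  (ex k).1 < (ex k).2.
Proof.
move=> ur Pk; have V0 := in_range_gt0 ur Pk; have [ud Au uB] := ur.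
have uA : u != A by apply: contraTneq Au => ->; rewrite ccw_lt_irr.
have u0 : ccw_lt A u (0, -1) by apply: (ccw_le_lt_trans Ad ud Bd) uB AB.
have [su|su] := ltP 0 (u.1 + u.2); last first.
  have u1 := ccw_arc_sum_le0 Ad A_ge0 ud uA u0 su.
  move: V0; rewrite /vpt; have y0 : 0 <= (ex k).2 by rewrite /= ler0n.
  have {}su : u.1%:~R + u.2%:~R <= 0 :> rat by rewrite -intrD lerz0.
  have {}u1 : u.1%:~R < 0 :> rat by rewrite ltrz0.
  by move: (ex k).1 (ex k).2 y0 => x y y0 V0; nra.
have c0 := ccw_arc_sum_gt0 Ad A_ge0 ud uA u0 su.
have : vpt A (ex k) <= vpt A (ex kA).
  by case: P_kA => _ /(_ k (proj1 Pk)) [/ltW|[->]].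
have : vpt u (ex kA) <= vpt u (ex k).
  by case: Pk => _ /(_ kA (proj1 P_kA)) [/ltW|[->]].
have {}c0 : 0 < A.1%:~R * u.2%:~R - A.2%:~R * u.1%:~R :> rat.
  by rewrite -!intrM -intrB ltr0z.
have {}su : 0 < u.1%:~R + u.2%:~R :> rat by rewrite -intrD ltr0z.
have A0 : 0 <= A.1%:~R + A.2%:~R :> rat by rewrite -intrD ler0z.
rewrite /vpt.
move: (ex k) (ex kA) kA_above => [x y] [x0 y0] /=.
set a := A.1%:~R in c0 A0 *; set b := A.2%:~R in c0 A0 *.
set r := u.1%:~R in c0 su *; set t := u.2%:~R in c0 su *.
move=> xy Vu VA.
(* Maximality of [k] in direction [u] and of [kA] in direction [A] fixes the signs of the two degree
   differences. As [cross A u] is positive, y - x is at least y0 - x0. *)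
have E : (a + b) * ((r * x + t * y) - (r * x0 + t * y0))
  = (r + t) * ((a * x + b * y) - (a * x0 + b * y0))
    + (a * t - b * r) * ((y - x) - (y0 - x0)) by ring.
have h1 : 0 <= (a + b) * ((r * x + t * y) - (r * x0 + t * y0)).
  by rewrite mulr_ge0 // subr_ge0.
have h2 : 0 <= (r + t) * ((a * x0 + b * y0) - (a * x + b * y)).
  by rewrite mulr_ge0 ?subr_ge0 // ltW.
have : 0 <= (a * t - b * r) * ((y - x) - (y0 - x0)) by lra.
by rewrite pmulr_rge0 //; lra.
Qed.

(** Quantifying over [eps] covers both ends of the leading forms: start points enter the bracket
    argument, end points carry the ratio to the next direction. *)
Definition aligned T (s : rat) u : Prop :=
  bracket (ell u T) (ell u P) = 0 /\
  forall eps kT kP, eps != 0 -> lexmax eps u T kT -> lexmax eps u P kP ->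
    ex kT = scale_pt s (ex kP).

(** Commuting leading forms have parallel extreme exponents at either end; the ratio is that of the
    degrees, which the start points already determine. *)
Lemma aligned_start T s u kT kP : in_range u ->
    bracket (ell u T) (ell u P) = 0 ->
    lexmax (-1) u T kT -> lexmax (-1) u P kP -> ex kT = scale_pt s (ex kP) ->
  aligned T s u.
Proof.
move=> ur br0 Tk Pk E; split=> // eps kT' kP' e0 Tk' Pk'; have [ud _ _] := ur.
have V0 := in_range_gt0 ur Pk'.
apply: (proportional (u := u)).
- apply/eqP; rewrite cross_expo //; apply/eqP.
  exact: (bracket0_kcross charK l_gt0 ud e0 (lexmax_ell Tk') (lexmax_ell Pk')).
- exact: lt0r_neq0.
have := lexmax_vdeg Tk'; rewrite (lexmax_vdeg Tk) => -[<-].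
have := lexmax_vdeg Pk'; rewrite (lexmax_vdeg Pk) => -[<-].
by rewrite E vptZ.
Qed.

Lemma propagate T kT (s s' : rat) : lexmax 1 A T kT ->
    ex kT = scale_pt s (ex kA) ->
    (bracket T P != 0 -> forall u, in_range u -> aligned (bracket T P) s' u) ->
  forall u, in_range u -> aligned T s u.
Proof.
move=> Tk kTE T'al u ur; have [ud _ _] := ur.
pose supp := (msupp P : seq _) ++ msupp T.
(* [D] contains the normals of all segments between exponents of [P] and [T], so that leading forms
   change only there. The first three entries provide a starting direction and keep gaps below a
   half turn. *)
pose D := [seq w <- [:: A, (- A.1, - A.2), (- A.2, A.1)
  & [seq edge_dir k k' | k <- supp, k' <- supp]] | direction w].
have Dd : {in D, forall d, direction d} by move=> d; rewrite mem_filter => /andP[].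
have AD : A \in D by rewrite mem_filter Ad mem_head.
move: u ud ur; apply: (ccw_ind Ad Dd) => u ud IH ur.
have [_ Au uB] := ur.
have [d [dD du gap]] := ccw_predecessor Ad Dd ud AD Au.
have dd := Dd d dD.
have d_u : 0 < cross d u.
  apply: (ccw_lt_gap Ad dd ud du) => w wA; apply: gap.
  have wd : direction w.
    move: wA; rewrite !inE => /orP[] /eqP -> /=.
      by rewrite /direction /= coprimezN coprimeNz.
    by rewrite /direction /= coprimeNz coprimez_sym.
  by move: wA; rewrite mem_filter wd !inE => /orP[] ->; rewrite ?orbT.
(* No normal lies strictly between [d] and [u], so the end point at [d] is the start point at
   [u]. *)
have vertex f k k' : {subset msupp f <= supp} ->
    lexmax 1 d f k' -> lexmax (-1) u f k -> k = k'.
  move=> fsupp dk' uk; apply/eqP/negPn/negP => kk'.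
  have [wd dw wu] := edge_dir_between dd ud d_u dk' uk kk'.
  have [ltdw ltwu] := ccw_lt_cone Ad dd wd ud du d_u dw wu.
  apply: (gap (edge_dir k k')) => //; rewrite mem_filter wd !inE; apply/orP; right.
  apply/orP; right; apply/orP; right; apply: allpairs_f; apply: fsupp.
    exact: proj1 uk.
  exact: proj1 dk'.
have [kP uP] := lexmax_exists (-1) u P_neq0.
have [dP_k dPmax] := lexmax_exists 1 d P_neq0.
have T_neq0 := lexmax_neq0 Tk.
have [kT' uT] := lexmax_exists (-1) u T_neq0.
have [dT_k dTmax] := lexmax_exists 1 d T_neq0.
have EP : kP = dP_k.
  by apply: vertex dPmax uP => k kP'; rewrite mem_cat kP'.
have ET : kT' = dT_k.
  by apply: vertex dTmax uT => k kT0; rewrite mem_cat kT0 orbT.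
(* At [d = A] the ratio of the end points is given; at later [d] it is the induction hypothesis. *)
have E : ex kT' = scale_pt s (ex kP).
  rewrite EP ET; have [dA|dA] := eqVneq d A.
    have up : @GRing.one rat != 0 by exact: oner_neq0.
    rewrite dA in dTmax dPmax.
    rewrite (lexmax_expo Ad up dTmax Tk) (lexmax_expo Ad up dPmax P_kA).
    exact: kTE.
  have dr : in_range d.
    split=> //; first exact: ccw_lt_self.
    case/orP: uB => [/eqP <-|uB]; first by rewrite /ccw_le du orbT.
    by rewrite /ccw_le (ccw_lt_trans Ad dd ud Bd du uB) orbT.
  have [_ al] := IH d dD du dr.
  exact: (al 1 _ _ (oner_neq0 _) dTmax dPmax).
apply: (aligned_start ur _ uT uP E).
apply: (bracket_ell_eq0 (s' := s') ud uP uT E)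
  (in_range_gt0 ur uP) (start_above_diagonal ur uP).
move=> k kbr; have [_ al] := T'al (lexmax_neq0 kbr) u ur.
by apply: (al (-1)) => //; rewrite oppr_eq0 oner_neq0.
Qed.

(** The downward induction along the iterated brackets becomes an induction on [N] with [T] general:
    [bracket T P] vanishes one iteration earlier. *)
Lemma aligned_nilpotent N T kT : 0 < vpt A (ex kA) ->
    iter_bracket T P N = 0 ->
    (forall j k, lexmax 1 A (iter_bracket T P j) k -> cross (ex k) (ex kA) = 0) ->
    lexmax 1 A T kT ->
  forall u, in_range u -> aligned T (vpt A (ex kT) / vpt A (ex kA)) u.
Proof.
move=> VA; elim: N T kT => [|N IHN] T kT TN crossT Tk.
  by have := lexmax_neq0 Tk; rewrite -[T]/(iter_bracket T P 0) TN eqxx.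
have kTE : ex kT = scale_pt (vpt A (ex kT) / vpt A (ex kA)) (ex kA).
  apply: (proportional (u := A)); [exact: (crossT 0%N)|exact: lt0r_neq0|].
  by rewrite divfK // lt0r_neq0.
have shiftE j : iter_bracket (bracket T P) P j = iter_bracket T P j.+1.
  by rewrite /iter_bracket iterSr.
have [br0|br0] := eqVneq (bracket T P) 0.
  (* With a vanishing bracket the premise on [s'] is vacuous, so any value serves. *)
  by apply: (propagate (s' := 0) Tk kTE); rewrite br0 eqxx.
have [k brk] := lexmax_exists 1 A br0.
apply: (propagate Tk kTE) => _; apply: (IHN _ k) => //; first by rewrite shiftE.
by move=> j k'; rewrite shiftE; exact: crossT.
Qed.

End Propagation.

(** * Local nilpotency of a derivation on a subalgebra *)

Section LocallyNilpotent.
Context {K : nzRingType} {R : comAlgType K} (D : R -> R).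
Hypotheses (DD : forall f g, D (f + g) = D f + D g).
Hypotheses (DZ : forall c f, D (c *: f) = c *: D f).
Hypotheses (DM : forall f g, D (f * g) = D f * g + f * D g).
Implicit Types f g : R.

Let iter_D j f g : iter j D (f + g) = iter j D f + iter j D g.
Proof. by elim: j => //= j ->. Qed.

Let iter_Z j c f : iter j D (c *: f) = c *: iter j D f.
Proof. by elim: j => //= j ->. Qed.

Let iter_0 j : iter j D 0 = 0.
Proof. by have := iter_Z j 0 0; rewrite !scale0r. Qed.

Let iter_le i j f : (i <= j)%N -> iter i D f = 0 -> iter j D f = 0.
Proof. by move=> ij f0; rewrite -(subnK ij) iterD f0 iter_0. Qed.

(** One application of the Leibniz rule leaves [D f * g] and [f * D g], and in each of them one
    factor dies one step earlier; hence induction on [i + j]. *)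
Let iter_M i j f g : iter i D f = 0 -> iter j D g = 0 -> iter (i + j) D (f * g) = 0.
Proof.
move: f g; have [n] := ubnP (i + j)%N.
elim: n i j => // n IHn [|i] [|j] ijn f g.
- by move=> f0 _; rewrite (f0 : f = 0) mul0r iter_0.
- by move=> f0 _; rewrite (f0 : f = 0) mul0r iter_0.
- by move=> _ g0; rewrite (g0 : g = 0) mulr0 iter_0.
move=> f0 g0; rewrite addSn iterSr DM iter_D.
rewrite IHn ?add0r //; [|by rewrite -iterSr].
rewrite -addSnnS IHn //; last by rewrite -iterSr.
by rewrite addSnnS.
Qed.

Lemma subalg_closed_nilpotent :
  GRing.subalg_closed [pred f | `[< exists j, iter j D f = 0 >]].
Proof.
have D1 : D 1 = 0.
  by have := DM 1 1; rewrite !mulr1 mul1r -[LHS]addr0 => /addrI.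
split=> [|c f g|f g]; rewrite !inE; first by exists 1%N.
  move=> [i f0] [j g0]; exists (maxn i j).
  rewrite iter_D iter_Z (iter_le (leq_maxl i j) f0) (iter_le (leq_maxr i j) g0).
  by rewrite scaler0 addr0.
by move=> [i f0] [j g0]; exists (i + j)%N; exact: iter_M.
Qed.

End LocallyNilpotent.

(** The elements killed by iterating the bracket with [P] form a subalgebra. It contains [P], as
    [P, P] = 0, and [Q], as [Q, P] is a constant. *)
Lemma iter_bracket_nilpotent (K : fieldType) (l : nat) (P Q T : lpoly K l) c :
  bracket P Q = c%:A -> in_subalg P Q T -> exists j, iter_bracket T P j = 0.
Proof.
move=> PQ inT; have br1 : bracket 1 P = 0.
  have := bracketMl 1 1 P; rewrite !mulr1 mul1r -[LHS]addr0 => /addrI E.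
  by rewrite -E.
apply/asboolP; apply: (inT [pred f | `[< exists j, iter_bracket f P j = 0 >]]).
- apply: subalg_closed_nilpotent => [f g|b f|f g];
    [exact: bracketDl|exact: bracketZl|exact: bracketMl].
- by apply/asboolP; exists 1%N; exact: bracketff.
apply/asboolP; exists 2%N; rewrite /iter_bracket /=.
have -> : bracket Q P = (- c) *: 1 by rewrite bracketC PQ scaleNr.
by rewrite bracketZl br1 scaler0.
Qed.

(** * Commuting leading forms along the range from [rs0] to [rs1] *)

Theorem proposition7p1
  (K : closedFieldType) (charK : [pchar K] =i pred0)
  (l : nat) (l_gt0 : (0 < l)%N)
  (m n : nat) (m_gt1 : (1 < m)%N) (n_gt1 : (1 < n)%N) (mn : coprime m n)
  (P Q : lpoly K l)
  (PQ : exists2 c : K, c != 0 & bracket P Q = c%:A)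
  (v11 : (vdeg (1, 1)%R P / vdeg (1, 1)%R Q)%E = (m%:R / n%:R)%:E)
  (v10 : (vdeg (1, 0)%R P / vdeg (1, 0)%R Q)%E = (m%:R / n%:R)%:E)
  (T0 : lpoly K l) (T0_PQ : in_subalg P Q T0)
  (rs0 : int * int) (rs0_dir : direction rs0) (rs0_ge0 : 0 <= rs0.1 + rs0.2)
  (rs0_P : Dir P rs0) (v_rs0 : (0 < vdeg rs0 P)%E)
  (en_T : forall j : nat, iter_bracket T0 P j != 0 ->
     cross (en rs0 (iter_bracket T0 P j)) (en rs0 P) = 0)
  (a : int) (b : nat) (b_gt0 : (0 < b)%N)
  (en_P : scale_pt m%:R^-1 (en rs0 P) = (a%:~R / l%:R, b%:R))
  (en_Q : scale_pt n%:R^-1 (en rs0 Q) = (a%:~R / l%:R, b%:R))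
  (ab : (a%:~R / l%:R < b%:R :> rat))
  (rs1 : int * int)
  (rs1_P : pos_Dir P rs0 rs1)
  (rs1_max : forall u, pos_Dir P rs0 u -> ccw_le rs0 u rs1) :
  forall u : int * int, direction u ->
    ccw_lt rs0 rs0 u -> ccw_le rs0 u rs1 ->
  forall j : nat,
    bracket (ell u (iter_bracket T0 P j)) (ell u P) = 0 /\
    (vdeg u (iter_bracket T0 P j) / vdeg u P)%E =
      (vdeg rs0 (iter_bracket T0 P j) / vdeg rs0 P)%E.
Proof.
have [c _ PQc] := PQ.
have [N T0N] := iter_bracket_nilpotent PQc T0_PQ.
have vdeg0 u : vdeg u (0 : lpoly K l) = -oo%E.
  by rewrite /vdeg /Supp msupp0 big_nil.
have P0 : P != 0 by apply: contraTneq v_rs0 => ->; rewrite vdeg0.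
have enE (f : lpoly K l) k : lexmax 1 rs0 f k -> en rs0 f = @expo l k.
  move=> fk; have [ks fks] := lexmax_exists (-1) rs0 (lexmax_neq0 fk).
  exact: (en_lexmax l_gt0 rs0_dir fks fk).
have [kA PkA] := lexmax_exists 1 rs0 P0.
have VA : 0 < vpt rs0 (@expo l kA) by rewrite -lte_fin -(lexmax_vdeg PkA).
(* The end point of [P] is [m] times the point (a/l, b), which lies above the diagonal by [ab]. *)
have kA_above : (@expo l kA).1 < (@expo l kA).2.
  have m0 : 0 < m%:R^-1 :> rat by rewrite invr_gt0 ltr0n ltnW.
  rewrite (enE _ _ PkA) /scale_pt in en_P; case: en_P => E1 E2.
  by rewrite -(ltr_pM2l m0) E1 E2.
have [[rs1_dir _] [_ rs1_arc] rs1_pos] := rs1_P.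
move=> u ud rs0u urs1 j; set T := iter_bracket T0 P j.
have ur : in_range rs0 rs1 u by [].
have u_pos : (0 < vdeg u P)%E by apply: rs1_pos => //; rewrite /ccw_le rs0u orbT.
(* For [T = 0] both quotients are minus infinity divided by a positive number. *)
have [->|T_neq0] := eqVneq T 0.
  split; first by rewrite /ell msupp0 big_nil bracket0l.
  have [kP PkP] := lexmax_exists 1 u P0.
  rewrite !vdeg0; move: v_rs0 u_pos; rewrite (lexmax_vdeg PkA) (lexmax_vdeg PkP).
  rewrite !lte_fin => a0 u0; rewrite !inver !gt_eqF // !gt0_mulNye ?lte_fin ?invr_gt0 //.
have [kT Tk] := lexmax_exists 1 rs0 T_neq0.
(* The sequence starting at [T] is a tail of the one starting at [T0], and it stays zero once it is
   zero. *)
have TN : iter_bracket T P N = 0.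
  rewrite /T /iter_bracket -iterD addnC iterD -/(iter_bracket T0 P N) T0N.
  by elim: (j) => //= i ->; rewrite bracket0l.
have crossT i k : lexmax 1 rs0 (iter_bracket T P i) k ->
    cross (@expo l k) (@expo l kA) = 0.
  rewrite /T /iter_bracket -iterD => Tik.
  rewrite -(enE _ _ Tik) -(enE _ _ PkA).
  by apply: (en_T (i + j)%N); exact: lexmax_neq0 Tik.
have [br0 al] := aligned_nilpotent charK l_gt0 rs0_dir rs0_ge0 rs1_dir rs1_arc
  rs1_pos PkA kA_above VA TN crossT Tk ur.
split=> //.
have [kP PkP] := lexmax_exists 1 u P0.
have [kT' TkT'] := lexmax_exists 1 u T_neq0.
move: u_pos; rewrite (lexmax_vdeg PkP) (lexmax_vdeg TkT').
rewrite (lexmax_vdeg PkA) (lexmax_vdeg Tk) lte_fin => u0; rewrite !inver !gt_eqF // -!EFinM.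
rewrite (al 1 _ _ (oner_neq0 _) TkT' PkP) vptZ mulfK // lt0r_neq0 //.
Qed.
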